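(* Let $n,l,k$ be natural numbers such that $\gcd(kl,n)=1$ and $\gcd(e(l-1,k),2^n-1)=1$. Then the monomial $F(x)=x^{e(l,k)}$ is $0$-APN over $\mathbb{F}_{2^n}$.
   Context: For natural numbers $l,k$, define $e(l,k)=\sum_{j=0}^{l-1}2^{jk}=\frac{2^{lk}-1}{2^k-1}$ (with $e(0,k)=0$). A function $F:\mathbb{F}_{2^n}\to\mathbb{F}_{2^n}$ is called $x_0$-APN for $x_0\in\mathbb{F}_{2^n}$ if every pair $y,z\in\mathbb{F}_{2^n}$ with $F(x_0)+F(y)+F(z)+F(x_0+y+z)=0$ satisfies $(x_0+y)(x_0+z)(y+z)=0$; in particular $F$ is $0$-APN if $F(0)+F(y)+F(z)+F(y+z)=0$ implies $yz(y+z)=0$. *)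

(* Defs.v *)
From mathcomp Require Import all_boot all_order all_algebra all_field.
Set Implicit Arguments.
Unset Strict Implicit.
Unset Printing Implicit Defensive.

Import GRing.Theory.

Definition e (l k : nat) : nat := \sum_(j < l) 2 ^ (j * k).

(* Meant for fields of characteristic 2, where all signs are irrelevant. *)
Definition APN_at (K : finFieldType) (F : K -> K) (x0 : K) : Prop :=
  forall y z : K,
    (F x0 + F y + F z + F (x0 + y + z) = 0)%R ->
    ((x0 + y) * (x0 + z) * (y + z) = 0)%R.

(* Main.v *)
(** Write [q = 2 ^ k] and [N x = x ^+ e l k], so that [N x ^+ q * x = N x * x ^+ q ^ l].
    If [N (y + z) = N y + N z] with [y], [z] and [y + z] nonzero, raising this equation
    to the power [q] and clearing denominators gives
    [(N y * z - N z * y) * (y * z ^+ q ^ l - z * y ^+ q ^ l) = 0].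
    If the first factor vanishes, then [(z / y) ^+ (q * e l.-1 k) = 1], hence [z = y] by
    the second coprimality hypothesis.  If the second one does, then [z / y] is fixed by
    the Frobenius power [x |-> x ^+ 2 ^ (k * l)], hence by [x |-> x ^+ 2] since
    [k * l] is prime to [n]; so again [z = y]. *)

Require Import Defs.
From mathcomp Require Import all_boot all_order all_algebra all_field.
From mathcomp Require Import ring.

Set Implicit Arguments.
Unset Strict Implicit.
Unset Printing Implicit Defensive.

Import GRing.Theory.

Lemma eSl (l k : nat) : e l.+1 k = (2 ^ k * e l k).+1.
Proof.
rewrite /e big_ord_recl mul0n expn0 add1n big_distrr /=; congr _.+1.
by apply: eq_bigr => j _; rewrite -expnD mulSn.
Qed.

Lemma eSr (l k : nat) : e l.+1 k = e l k + 2 ^ (k * l).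
Proof. by rewrite /e big_ord_recr /= mulnC. Qed.

Local Open Scope ring_scope.

(** Both sides equal [x ^+ e l.+1 k]: the left splits off the first term of the sum, the right the
    last. *)
Lemma expr_e_frobenius (R : comNzRingType) (x : R) (l k : nat) :
  (x ^+ e l k) ^+ (2 ^ k) * x = x ^+ e l k * x ^+ (2 ^ (k * l)).
Proof. by rewrite -exprM -exprSr -exprD -eSr eSl mulnC. Qed.

Lemma expr_coprime_eq1 (R : pzRingType) (x : R) (a b : nat) :
  coprime a b -> x ^+ a = 1 -> x ^+ b = 1 -> x = 1.
Proof.
move=> cop_ab xa xb; have [|a0] := posnP a.
  by move=> a0; move: cop_ab xb; rewrite a0 /coprime gcd0n => /eqP ->.
have [u v Euv _] := egcdnP b a0.
move: Euv; rewrite (eqP cop_ab) => Euv.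
by rewrite -[LHS]mul1r -{1}(expr1n _ v) -{1}xb -exprM mulnC -exprSr -addn1 -Euv
   mulnC exprM xa expr1n.
Qed.

Lemma expr_pow_fixed (R : pzRingType) (x : R) (p m i : nat) :
  x ^+ (p ^ m) = x -> x ^+ (p ^ (i * m)) = x.
Proof.
by move=> xm; elim: i => [|i IHi]; rewrite ?expr1 // mulSn expnD exprM xm.
Qed.

Lemma expr_pow_fixed_coprime (R : pzRingType) (x : R) (p m n : nat) :
  (0 < n)%N -> coprime m n ->
  x ^+ (p ^ m) = x -> x ^+ (p ^ n) = x -> x ^+ p = x.
Proof.
rewrite coprime_sym => n_gt0 /eqP cop_nm xm xn.
have [u v Euv _] := egcdnP m n_gt0; move: Euv; rewrite cop_nm => Euv.
(* Bezout gives [u * n = v * m + 1], so [x] equals its power [p ^ (v * m + 1)], which collapses to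
   [x ^+ p]. *)
rewrite -[RHS](expr_pow_fixed u xn) Euv expnD exprM.
by rewrite (expr_pow_fixed v xm) expn1.
Qed.

Lemma expr_e_additive_split (F : fieldType) (y z : F) (l k : nat) :
  2%N \in [pchar F] -> y ^+ e l k + z ^+ e l k = (y + z) ^+ e l k ->
  (y ^+ e l k * z - z ^+ e l k * y) *
  (y * z ^+ (2 ^ (k * l)) - z * y ^+ (2 ^ (k * l))) = 0.
Proof.
move=> char2 addN; have frobD m (a b : F) : (a + b) ^+ (2 ^ m) = a ^+ (2 ^ m) + b ^+ (2 ^ m).
  by apply: exprDn_pchar; rewrite (eq_pnat _ (pcharf_eq char2)) pnatX pnat_id.
have := expr_e_frobenius (y + z) l k; rewrite -addN !frobD.
have := expr_e_frobenius y l k; have := expr_e_frobenius z l k.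
set A := y ^+ e l k; set B := z ^+ e l k.
set Aq := A ^+ _; set Bq := B ^+ _; set y' := y ^+ _; set z' := z ^+ _.
(* This is the right side of [y * z * EC - z * (y + z) * EA - y * (y + z) * EB]; on the left side of
   this combination, [Aq] and [Bq] cancel. *)
move=> EB EA EC; transitivity
  (y * z * ((A + B) * (y' + z')) - z * (y + z) * (A * y') - y * (y + z) * (B * z')).
  by ring.
by rewrite -EA -EB -EC; ring.
Qed.

Local Close Scope ring_scope.

Theorem theorem1 (n l k : nat) (K : finFieldType) (cardK : #|K| = 2 ^ n)
    (gcd_kl_n : gcdn (k * l) n = 1)
    (gcd_e : gcdn (e (l - 1) k) (2 ^ n - 1) = 1) :
  APN_at (fun x : K => (x ^+ e l k)%R) 0%R.
Proof.
have char2 : 2 \in [pchar K]%R by apply: card_finPcharP cardK _.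
have n_gt0 : 0 < n.
  by have := finNzRing_gt1 K; rewrite cardK; case: (n).
move=> y z; rewrite !add0r => sum0; apply/eqP; rewrite !mulf_eq0 -orbA.
have [//|y0 /=] := eqVneq y 0%R; have [//|z0 /=] := eqVneq z 0%R.
rewrite addr_eq0 (oppr_pchar2 char2) eq_sym.
set t := (z / y)%R; have t0 : t != 0%R by rewrite mulf_neq0 ?invr_eq0.
have zE : z = (t * y)%R by rewrite /t divfK.
clearbody t.
suff: t = 1%R by rewrite zE => ->; rewrite mul1r.
have fixed_t : (t ^+ (2 ^ (k * l)) = t -> t = 1)%R.
  move=> tkl; have tn : (t ^+ (2 ^ n) = t)%R by rewrite -cardK expf_card.
  have := expr_pow_fixed_coprime n_gt0 (introT eqP gcd_kl_n) tkl tn.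
  by rewrite expr2 -{3}[t]mulr1 => /(mulfI t0).
(* For [l = 0], the premise of [fixed_t] is just [t ^+ 1 = t]. *)
case: l gcd_kl_n gcd_e sum0 fixed_t => [|l] _ gcd_e sum0 fixed_t.
  by apply: fixed_t; rewrite muln0 expn0 expr1.
move: sum0; rewrite {1}eSl expr0n add0r => /eqP.
rewrite addr_eq0 (oppr_pchar2 char2) => /eqP /(expr_e_additive_split char2) /eqP.
rewrite mulf_eq0 !subr_eq0 zE !exprMn => /orP[] /eqP Et.
  (* Cancelling powers of [y] in [Et] leaves [t = t ^+ e l.+1 k], whose exponent is
     [2 ^ k * e l k + 1]; the factor [2 ^ k] is harmless as [2 ^ n - 1] is odd. *)
  apply: (@expr_coprime_eq1 _ t (2 ^ k * e l k) (2 ^ n - 1)).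
  - rewrite coprimeMl {2}/coprime -[e l k]/(e l.+1.-1 k) -subn1 gcd_e andbT.
    by rewrite coprimeXl // coprime2n oddB ?expn_gt0 // oddX; move: n_gt0; case: (n).
  - move: Et; rewrite eSl (exprS t) => Et.
    have yt0 : (y ^+ (2 ^ k * e l k).+1 * t * y != 0)%R.
      by rewrite !mulf_neq0 ?expf_neq0.
    apply: (mulfI yt0); rewrite mulr1 -[RHS]mulrA Et; ring.
  - by apply: (mulfI t0); rewrite mulr1 -exprS subn1 prednK ?expn_gt0 // -cardK expf_card.
apply: fixed_t; have yy0 : (y * y ^+ (2 ^ (k * l.+1)) != 0)%R.
  by rewrite mulf_neq0 ?expf_neq0.
by apply: (mulfI yy0); rewrite -[LHS]mulrA (mulrC (y ^+ _)%R) Et; ring.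
Qed.
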